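(* Let $A$ be a Dedekind domain. Then for any non-negative integer $n$ there exists an $n$-universal set in $A$ of size $n+2$.
   Context: For a domain $A$ with field of fractions $K$, a finite subset $S\subset A$ is called an $n$-universal set if the following holds: for every polynomial $P\in K[X]$ of degree at most $n$ one has $P(A)\subset A$ if and only if $P(S)\subset A$. *)

(* Defs.v *)
From mathcomp Require Import all_boot all_algebra finmap.

Set Implicit Arguments.
Unset Strict Implicit.
Unset Printing Implicit Defensive.

Import GRing.Theory.

Local Open Scope ring_scope.

(* [idealr_closed] describes the proper ideals; the unit ideal is generated by
   1, so quantifying over proper ideals is enough.  Under classical axioms
   every ideal is given by a boolean predicate. *)
Definition noetherian (A : idomainType) : Prop :=
  forall I : {pred A}, idealr_closed I ->
  exists gens : seq A, forall x : A,
    x \in I <->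
    exists c : 'I_(size gens) -> A, x = \sum_(i < size gens) c i * gens`_i.

Definition maximal_ideal (A : idomainType) (I : {pred A}) : Prop :=
  idealr_closed I /\
  forall J : {pred A}, idealr_closed J -> {subset I <= J} -> {subset J <= I}.

Definition in_base (A : idomainType) (z : {fraction A}) : Prop :=
  exists a : A, z = tofrac a.

Definition integrally_closed (A : idomainType) : Prop :=
  forall z : {fraction A}, integralOver (@tofrac A) z -> in_base z.

(* Krull dimension exactly one: fields are excluded by [dedekind_not_field]. *)
Record dedekind_domain (A : idomainType) : Prop := DedekindDomain {
  dedekind_not_field : exists2 a : A, a != 0 & a \isn't a GRing.unit;
  dedekind_noetherian : noetherian A;
  dedekind_integrally_closed : integrally_closed A;
  dedekind_prime_maximal : forall I : {pred A},
    idealr_closed I -> prime_idealr_closed I ->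
    (exists2 x : A, x \in I & x != 0) -> maximal_ideal I
}.

Definition universal_set (A : idomainType) (n : nat) (S : {fset A}) : Prop :=
  forall P : {poly {fraction A}}, (size P <= n.+1)%N ->
    (forall a : A, in_base P.[tofrac a]) <->
    (forall s : A, s \in S -> in_base P.[tofrac s]).

(* Main.v *)
Require Import Defs.
From mathcomp Require Import all_boot all_algebra finmap boolp ring.

(** Write [A_p] for the localization of [A] at a maximal ideal [p].  An
    element of the fraction field lies in [A] as soon as it lies in every
    [A_p] ([in_base_local]), so [S] is [n]-universal if for every [p] it
    contains [n+1] elements forming a [p]-ordering in the sense of Bhargava:
    the Newton interpolation formula through a [p]-ordering has coefficients
    that make every term [A_p]-valued ([newton_interpolation]).  In particular
    [n+1] elements that are pairwise incongruent modulo [p] will do.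

    The elements of [S] are chosen one after the other.  Fix [n+1] distinct
    elements of [A]; the product of their differences is a nonzero element
    lying in every [p] with at most [n] residue classes, so these small [p]
    are finite in number.  Given [s], choose the next element [x] so that the
    product of the differences [x - b], for [b] in [s], has minimal valuation
    at every small [p] and at every [p] that divides a difference of two
    elements of [s]; these are again finitely many ([finitely_many_maximal]),
    and being minimal is an open condition, so the Chinese remainder theorem
    provides [x] ([simultaneous_minimum]).

    At the small [p] this produces a [p]-ordering.  At a large [p] the first
    coincidence modulo [p], if there is any, involves exactly two elements,
    and from then on [p] is one of the ideals under control: all later
    elements fall in new residue classes.  Hence among [n+2] elements, [n+1]
    are pairwise incongruent modulo [p] ([extend_spread]); the one element
    beyond the obvious [n+1] pays for this coincidence.

    The arithmetic needed is that [A_p] is a discrete valuation ring for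
    nonzero [p] ([uniformizer], [uniformizer_power]); it is phrased with
    elements of [A] and denominators outside [p]. *)

Set Implicit Arguments.
Unset Strict Implicit.
Unset Printing Implicit Defensive.

Import GRing.Theory.

Local Open Scope ring_scope.

(** * Ideals of a Noetherian domain *)

Section Ideals.

Variable A : idomainType.
Implicit Types (I J p q : {pred A}) (F : {pred A} -> Prop).

Lemma ideal_mul I x y : idealr_closed I -> x \in I -> y * x \in I.
Proof. by case=> I0 _ hI xI; rewrite -[y * x]addr0 hI. Qed.

Lemma ideal_add I x y : idealr_closed I -> x \in I -> y \in I -> x + y \in I.
Proof. by case=> _ _ hI xI yI; rewrite -[x]mul1r hI. Qed.

Lemma ideal_sub I x y : idealr_closed I -> x \in I -> y \in I -> x - y \in I.
Proof. by case=> _ _ hI xI yI; rewrite addrC -mulN1r hI. Qed.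

Lemma ideal_comb I n (c f : 'I_n -> A) :
  idealr_closed I -> (forall i, f i \in I) -> \sum_(i < n) c i * f i \in I.
Proof.
move=> hI fI; apply: (big_ind (fun x => x \in I)); first by case: hI.
  by move=> x y; exact: ideal_add.
by move=> i _; exact: ideal_mul.
Qed.

Lemma ideal_of_prop (P : A -> Prop) :
  P 0 -> ~ P 1 -> (forall a u v, P u -> P v -> P (a * u + v)) ->
  idealr_closed [pred x | `[< P x >]].
Proof.
move=> P0 P1 PD; split; rewrite ?inE; [exact/asboolP | exact/asboolPn |].
by move=> a u v /asboolP Pu /asboolP Pv; apply/asboolP/PD.
Qed.

Lemma noetherian_generators I : noetherian A -> idealr_closed I ->
  exists gens : seq A, (forall i : 'I_(size gens), gens`_i \in I) /\
    forall x, x \in I ->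
      exists c : 'I_(size gens) -> A, x = \sum_(i < size gens) c i * gens`_i.
Proof.
move=> hN /hN [gens gensP]; exists gens; split=> [i|x /gensP //].
apply/gensP; exists (fun j => (j == i)%:R).
rewrite (bigD1 i) //= eqxx mul1r big1 ?addr0 // => j /negPf ->.
by rewrite mul0r.
Qed.

Lemma noetherian_acc (I : nat -> {pred A}) :
  noetherian A -> (forall k, idealr_closed (I k)) ->
  (forall k, {subset I k <= I k.+1}) ->
  exists N, {subset I N.+1 <= I N}.
Proof.
move=> hN hI incr.
have mono k l x : (k <= l)%N -> x \in I k -> x \in I l.
  elim: l => [|l IHl]; first by rewrite leqn0 => /eqP ->.
  rewrite leq_eqVlt => /predU1P [-> //|/IHl {}IHl /IHl]; exact: incr.
pose U := [pred x | `[< exists k, x \in I k >]].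
have /(noetherian_generators hN) [gens [gensU gensP]] : idealr_closed U.
  apply: ideal_of_prop; first by exists 0; case: (hI 0).
    by case=> k; apply/negP; case: (hI k).
  move=> a u v [k uk] [l vl]; exists (maxn k l).
  by case: (hI (maxn k l)) => _ _; apply;
     [apply: mono uk; exact: leq_maxl | apply: mono vl; exact: leq_maxr].
have /choice [k kP] : forall i : 'I_(size gens), exists k, gens`_i \in I k.
  by move=> i; exact/asboolP/gensU.
exists (\max_i k i)%N => x xI.
have /gensP [c ->] : x \in U by apply/asboolP; eexists; exact: xI.
apply: ideal_comb => // i; apply: mono (kP i); exact: leq_bigmax.
Qed.

(** A family without a maximal member would yield, by dependent choice, a
    strictly increasing sequence of ideals. *)
Lemma noetherian_maximal F :
  noetherian A -> (forall I, F I -> idealr_closed I) -> (exists I, F I) ->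
  exists2 I, F I & forall J, F J -> {subset I <= J} -> {subset J <= I}.
Proof.
move=> hN FI [I0 FI0]; apply: contrapT => noMax.
have next (I : {I | F I}) : exists J : {J | F J},
    {subset sval I <= sval J} /\ ~ {subset sval J <= sval I}.
  case: I => I hI /=; apply: contrapT => noJ.
  apply: noMax; exists I => // J FJ IJ.
  by apply: contrapT => nJI; apply: noJ; exists (exist _ J FJ).
have [f fP] := choice next.
pose C k := sval (iter k f (exist _ I0 FI0)).
have [||N] := @noetherian_acc C hN.
- by move=> k; apply: FI; exact: (svalP (iter k f _)).
- by move=> k; case: (fP (iter k f (exist _ I0 FI0))).
by case: (fP (iter N f (exist _ I0 FI0))).
Qed.

Lemma ideal_sub_maximal I : noetherian A -> idealr_closed I ->
  exists2 p, maximal_ideal p & {subset I <= p}.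
Proof.
move=> hN hI.
have [||p [hp Ip] pmax] := @noetherian_maximal
  (fun J => idealr_closed J /\ {subset I <= J}) hN.
- by move=> J [].
- by exists I; split.
exists p => //; split=> // J hJ pJ; apply: pmax => //; split=> // x xI.
exact/pJ/Ip.
Qed.

(** Otherwise the elements congruent to a multiple of [x] modulo [p] would
    form a proper ideal strictly larger than [p]. *)
Lemma maximal_inverse p x : maximal_ideal p -> x \notin p ->
  exists v, 1 - x * v \in p.
Proof.
move=> [hp pmax] xp; apply: contrapT => nov; apply: (negP xp).
have hJ : idealr_closed [pred y | `[< exists v, y - x * v \in p >]].
  apply: ideal_of_prop => //; first by exists 0; rewrite mulr0 subr0; case: hp.
  move=> a u w [v uv] [v' wv']; exists (a * v + v').
  have -> : a * u + w - x * (a * v + v')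
    = a * (u - x * v) + (w - x * v') by ring.
  by case: hp => _ _; apply.
apply: (pmax _ hJ) => [y yp|]; apply/asboolP.
  by exists 0; rewrite mulr0 subr0.
by exists 1; rewrite mulr1 subrr; case: hp.
Qed.

Lemma maximal_closed p : maximal_ideal p -> idealr_closed p.
Proof. by case. Qed.

Lemma maximal_prime p x y :
  maximal_ideal p -> x \notin p -> y \notin p -> x * y \notin p.
Proof.
move=> pM /(maximal_inverse pM) [v xv]; apply: contra => xyp.
have -> : y = y * (1 - x * v) + v * (x * y) by ring.
have hp := maximal_closed pM.
by apply: ideal_add => //; exact: ideal_mul.
Qed.

Lemma maximal_one p : maximal_ideal p -> 1 \notin p.
Proof. by case=> -[]. Qed.

Lemma maximal_exp p x k : maximal_ideal p -> x \notin p -> x ^+ k \notin p.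
Proof.
move=> pM xp; elim: k => [|k IHk]; first exact: maximal_one.
by rewrite exprS maximal_prime.
Qed.

Lemma maximal_sep p q : maximal_ideal p -> maximal_ideal q -> p <> q ->
  exists2 x, x \in q & x \notin p.
Proof.
move=> [hp pmax] [hq qmax] pq; apply: contrapT => nox; apply: pq.
have qp : {subset q <= p}.
  by move=> x xq; apply: contrapT => /negP xp; apply: nox; exists x.
have pq : {subset p <= q} by exact: qmax.
apply/funext => x; apply/idP/idP; [exact: pq | exact: qp].
Qed.

(** This is divisibility in the local ring at [p]; clearing the denominator [d]
    keeps it a relation on [A], so that no localization has to be built. *)
Definition ldvd p u w := exists d, exists c, d \notin p /\ d * w = c * u.

Lemma ldvd_unit p u w : u \notin p -> ldvd p u w.
Proof. by move=> up; exists u, w; rewrite mulrC. Qed.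

Lemma ldvd_notin p u w :
  maximal_ideal p -> ldvd p u w -> w \notin p -> u \notin p.
Proof.
move=> pM [d [c [dp e]]] wp; apply: contra (maximal_prime pM dp wp) => up.
by rewrite e ideal_mul //; exact: maximal_closed.
Qed.

Lemma ldvd_trans p u v w : maximal_ideal p ->
  ldvd p u v -> ldvd p v w -> ldvd p u w.
Proof.
move=> pM [d [c [dp e]]] [d' [c' [dp' e']]].
exists (d * d'), (c' * c); split; first exact: maximal_prime.
by rewrite -mulrA e' mulrCA e mulrA.
Qed.

End Ideals.

(** * Valuations and approximation in a Dedekind domain *)

Section Dedekind.

Variable A : idomainType.
Hypothesis hA : dedekind_domain A.
Implicit Types (I J p q : {pred A}) (m : A).

Let hN : noetherian A := dedekind_noetherian hA.

(** [P x d] stands for: [d] is a denominator of [x].  As [p] is finitely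
    generated, the product of the denominators of its generators serves all of
    [p] at once. *)
Lemma maximal_common_denominator p (P : A -> A -> Prop) : maximal_ideal p ->
  (forall x d e, P x d -> P x (e * d)) ->
  (forall d, P 0 d) ->
  (forall d a x y, P x d -> P y d -> P (a * x + y) d) ->
  (forall x, x \in p -> exists2 d, d \notin p & P x d) ->
  exists2 d, d \notin p & forall x, x \in p -> P x d.
Proof.
move=> pM PM P0 PD Pp.
have [gens [gensp gensP]] := noetherian_generators hN (maximal_closed pM).
have /choice [d dP] : forall i : 'I_(size gens),
    exists d, d \notin p /\ P gens`_i d.
  move=> i; have [d dp Pd] := Pp _ (gensp i).
  by exists d.
exists (\prod_i d i).
  apply: (big_ind (fun x => x \notin p)); first exact: maximal_one.
    by move=> x y; exact: maximal_prime.
  by move=> i _; case: (dP i).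
move=> x /gensP [c ->]; apply: (big_ind (fun x => P x _)) => //.
  by move=> y z Py Pz; rewrite -[y]mul1r; exact: PD.
move=> i _; rewrite -[_ * _]addr0; apply: PD => //.
by rewrite (bigD1 i) //= mulrC; apply: PM; case: (dP i).
Qed.

(** Over the local ring [p] is an associated prime of the module [A/(m)].
    Among the proper ideals [J b] of local annihilators of the class of [b] in
    [A/(m)] a maximal one is prime; it contains [m], hence is maximal since
    the dimension is one, hence equals [p].  The fraction [b/m] is then an
    element of the inverse ideal of [p] that is not in the local ring. *)
Lemma maximal_colon p m : maximal_ideal p -> m \in p -> m != 0 ->
  exists b, (forall y, y \in p -> exists c, y * b = c * m) /\
            (forall t c, t \notin p -> t * b <> c * m).
Proof.
move=> pM mp m0.
pose J b : {pred A} :=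
  [pred x | `[< exists s c, s \notin p /\ s * (x * b) = c * m >]].
pose F I := exists b, I = J b /\ 1 \notin J b.
have JM b : 1 \notin J b -> idealr_closed (J b).
  move=> Jb; apply: ideal_of_prop.
  - by exists 1, 0; rewrite !(mul0r, mulr0); split=> //; exact: maximal_one.
  - by move/asboolP; apply/negP.
  move=> a x y [s [c [sp e]]] [s' [c' [sp' e']]].
  exists (s * s'), (s' * a * c + s * c'); split; first exact: maximal_prime.
  have -> : s * s' * ((a * x + y) * b)
    = s' * a * (s * (x * b)) + s * (s' * (y * b)) by ring.
  by rewrite e e'; ring.
have [||_ [b [-> Jb]] Jmax] := @noetherian_maximal A F hN.
- by move=> _ [b [-> /JM]].
- exists (J 1), 1; split=> //; apply/asboolPn => -[s [c [sp]]].
  rewrite !mulr1 => e; apply: (negP sp); rewrite e.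
  by apply: ideal_mul => //; exact: maximal_closed.
have mJ : m \in J b.
  apply/asboolP; exists 1, b; rewrite mul1r mulrC.
  by split=> //; exact: maximal_one.
have Jprime : prime_idealr_closed (J b).
  move=> x y /asboolP [s [c [sp e]]]; apply/orP.
  have [xJ|xJ] := boolP (x \in J b); [by left | right].
  apply: (Jmax (J (x * b))).
  - exists (x * b); split=> //; apply: contra xJ => /asboolP [s' [c' [sp' e']]].
    by apply/asboolP; exists s', c'; rewrite -e' mul1r.
  - move=> z /asboolP [s' [c' [sp' e']]]; apply/asboolP.
    by exists s', (x * c'); split=> //; rewrite -mulrA -e'; ring.
  by apply/asboolP; exists s, c; split=> //; rewrite -e; ring.
have JMax : maximal_ideal (J b).
  by apply: dedekind_prime_maximal => //; [exact: JM | exists m].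
have Jp : {subset J b <= p}.
  move=> x /asboolP [s [c [sp e]]]; apply: contrapT => /negP xp.
  apply: (negP Jb); apply/asboolP; exists (s * x), c; split.
    exact: maximal_prime.
  by rewrite -e; ring.
have pJ : {subset p <= J b} := JMax.2 _ (maximal_closed pM) Jp.
have [s sp sP] : exists2 s, s \notin p &
    forall x, x \in p -> exists c, s * (x * b) = c * m.
  pose P x s := exists c, s * (x * b) = c * m.
  apply: (maximal_common_denominator (P := P)) => //.
  - by move=> x d e [c E]; exists (e * c); rewrite -!mulrA E.
  - by move=> d; exists 0; rewrite !(mul0r, mulr0).
  - move=> d a x y [c e] [c' e']; exists (a * c + c').
    have -> : d * ((a * x + y) * b)
      = a * (d * (x * b)) + d * (y * b) by ring.
    by rewrite e e'; ring.
  by move=> x /pJ /asboolP [s [c [sp e]]]; exists s => //; exists c.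
exists (s * b); split=> [y /sP [c e]|t c tp e].
  by exists c; rewrite -e; ring.
apply: (negP Jb); apply/asboolP; exists (t * s), c.
by rewrite mul1r -e mulrA; split=> //; exact: maximal_prime.
Qed.

(** The Cayley-Hamilton argument: [z] is an eigenvalue of a matrix over [A],
    hence a root of its characteristic polynomial. *)
Lemma integral_of_stable (z : {fraction A}) n (g : 'I_n -> A) (C : 'M[A]_n) :
  (forall i, z * tofrac (g i) = \sum_j tofrac (C i j * g j)) ->
  (exists i, g i != 0) -> integralOver (@tofrac A) z.
Proof.
move=> zg [i0 gi0].
(* Eigenvectors are rows here, whence the transpose. *)
exists (char_poly C^T); first exact: char_poly_monic.
rewrite map_char_poly -eigenvalue_root_char; apply/eigenvalueP.
exists (\row_i tofrac (g i)).
  apply/rowP => i; rewrite !mxE zg; apply: eq_bigr => j _.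
  by rewrite !mxE mulrC -tofracM.
apply/eqP => /rowP /(_ i0); rewrite !mxE => /eqP.
by rewrite tofrac_eq0 (negPf gi0).
Qed.

(** The local ring at [p] has principal maximal ideal, which is where integral
    closedness enters.  With [z = b/m] given by [maximal_colon], [z p] is
    contained in [A].  If it were contained in [p], then [z] would be
    integral, hence in [A], contrary to the choice of [b].  So [z * pi] lies
    outside [p] for some [pi] in [p], and [z * pi * y = pi * (z * y)] shows
    that [pi] generates [p] locally. *)
Lemma uniformizer p m : maximal_ideal p -> m \in p -> m != 0 ->
  exists pi, exists u, [/\ pi \in p, u \notin p &
    forall y, y \in p -> exists c, u * y = c * pi].
Proof.
move=> pM mp m0; have [b [bp bN]] := maximal_colon pM mp m0.
have [[pi [u [pip [up e]]]]|noPi] :=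
    EM (exists pi, exists u, pi \in p /\ u \notin p /\ pi * b = u * m).
  exists pi, u; split=> // y /bp [c e']; exists c.
  apply: (mulIf m0); rewrite mulrAC -e.
  by rewrite [RHS]mulrAC -e'; ring.
exfalso.
have bpp y : y \in p -> exists2 c, c \in p & y * b = c * m.
  move=> yp; have [c e] := bp y yp; exists c => //.
  by apply: contrapT => /negP cp; apply: noPi; exists y, c.
have [gens [gensp gensP]] := noetherian_generators hN (maximal_closed pM).
set n := size gens in gensp gensP.
have /choice [C CP] : forall i : 'I_n, exists C : 'I_n -> A,
    gens`_i * b = (\sum_j C j * gens`_j) * m.
  move=> i; have [c /gensP [k ->] e] := bpp _ (gensp i).
  by exists k.
have m0' : tofrac m != 0 by rewrite tofrac_eq0.
have : in_base (tofrac b / tofrac m).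
  apply: (dedekind_integrally_closed hA).
  apply: (@integral_of_stable _ n (fun i => gens`_i) (\matrix_(i, j) C i j)).
    move=> i; rewrite -rmorph_sum /=; apply: (mulIf m0').
    rewrite mulrAC divfK // -!tofracM mulrC CP; congr (tofrac (_ * _)).
    by apply: eq_bigr => j _; rewrite mxE.
  apply: contrapT => g0; case/gensP: mp m0 => c ->.
  rewrite big1 ?eqxx // => i _.
  have [->|gi] := eqVneq gens`_i 0; first by rewrite mulr0.
  by case: g0; exists i.
case=> a /(congr1 (fun x => x * tofrac m)); rewrite divfK // -tofracM => /eqP.
rewrite tofrac_eq => /eqP e; apply: (bN 1 a); first exact: maximal_one.
by rewrite mul1r.
Qed.


(** The exponent [N] is the valuation of [w] at [p].  If [w] were locally
    divisible by every power of [pi], with quotients [c_k], then the ascending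
    ideals [w : pi^k] would stop growing at some [N]; as [c_(N+1)] lies in the
    ideal of index [N+1], hence of index [N], [pi] would be locally a unit. *)
Lemma uniformizer_power p pi u w : maximal_ideal p -> pi \in p -> u \notin p ->
  (forall y, y \in p -> exists c, u * y = c * pi) -> w != 0 ->
  exists N d e, [/\ d \notin p, e \notin p & d * w = pi ^+ N * e].
Proof.
move=> pM pip up piP w0; apply: contrapT => noN.
have hp := maximal_closed pM.
have divisible k : exists d c, d \notin p /\ d * w = pi ^+ k * c.
  elim: k => [|k [d [c [dp e]]]].
    by exists 1, w; split; [exact: maximal_one | rewrite expr0].
  have cp : c \in p.
    by apply: contrapT => /negP cp; apply: noN; exists k, d, c.
  have [c' e'] := piP _ cp; exists (u * d), c'; split.
    exact: maximal_prime.
  by rewrite -mulrA e exprS mulrCA e'; ring.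
pose I k : {pred A} :=
  [pred x | `[< exists d c, d \notin p /\ d * (pi ^+ k * x) = c * w >]].
have [[N IN]|noAcc] := EM (exists N, {subset I N.+1 <= I N}).
  have [d [c [dp e]]] := divisible N.+1.
  have /IN /asboolP [d' [c' [dp' e']]] : c \in I N.+1.
    apply/asboolP; exists 1, d; rewrite mul1r.
    by split => //; exact: maximal_one.
  apply: (negP (maximal_prime pM dp' dp)).
  have -> : d' * d = c' * pi.
    apply: (mulIf w0); rewrite -mulrA e exprS.
    have -> : d' * (pi * pi ^+ N * c) = pi * (d' * (pi ^+ N * c)) by ring.
    by rewrite e'; ring.
  exact: ideal_mul.
apply: noAcc; apply: noetherian_acc => // k.
  apply: ideal_of_prop.
  - by exists 1, 0; rewrite !(mulr0, mul0r); split => //; exact: maximal_one.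
  - case=> d' [c' []]; rewrite mulr1 => dp' e'.
    have [d [c [dp e]]] := divisible k.+1.
    apply: (negP (maximal_prime pM dp' dp)).
    have -> : d' * d = c' * c * pi.
      apply: (mulIf w0); rewrite -mulrA e exprS.
      have -> : c' * c * pi * w = pi * c * (c' * w) by ring.
      by rewrite -e'; ring.
    exact: ideal_mul.
  move=> a x y [d [c [dp e]]] [d' [c' [dp' e']]].
  exists (d * d'), (d' * a * c + d * c'); split; first exact: maximal_prime.
  have -> : d * d' * (pi ^+ k * (a * x + y)) =
    d' * a * (d * (pi ^+ k * x)) + d * (d' * (pi ^+ k * y)) by ring.
  by rewrite e e'; ring.
move=> x /asboolP [d [c [dp e]]]; apply/asboolP; exists d, (pi * c).
by split=> //; rewrite -mulrA -e exprS; ring.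
Qed.

(** Any nonzero value of [f] of least valuation divides all the others. *)
Lemma local_minimum p m (f : A -> A) :
  maximal_ideal p -> m \in p -> m != 0 -> (exists y, f y != 0) ->
  exists2 x, f x != 0 & forall y, ldvd p (f x) (f y).
Proof.
move=> pM mp m0 [y0 fy0]; have [pi [u [pip up piP]]] := uniformizer pM mp m0.
have factor := uniformizer_power pM pip up piP.
pose P N := `[< exists x d e,
  [/\ f x != 0, d \notin p, e \notin p & d * f x = pi ^+ N * e] >].
have exP : exists N, P N.
  have [N [d [e [dp ep E]]]] := factor _ fy0.
  by exists N; apply/asboolP; exists y0, d, e.
case: (ex_minnP exP) => N /asboolP [x [d [e [fx0 dp ep E]]]] Nmin.
exists x => // y; have [->|fy] := eqVneq (f y) 0.
  by exists 1, 0; rewrite mulr0 mul0r; split=> //; exact: maximal_one.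
have [M [d' [e' [dp' ep' E']]]] := factor _ fy.
have NM : (N <= M)%N by apply: Nmin; apply/asboolP; exists y, d', e'.
exists (e * d'), (pi ^+ (M - N) * e' * d); split; first exact: maximal_prime.
rewrite -!mulrA E E'.
by rewrite -{1}(subnK NM) exprD; ring.
Qed.

(** Turns congruence modulo a high power of [p] into divisibility by [w], with
    a cofactor in [p]: this makes being a local minimum an open condition. *)
Lemma local_power_divisible p m w : maximal_ideal p -> m \in p -> m != 0 ->
  w != 0 -> exists N, forall r, r \in p ->
    exists d c, [/\ d \notin p, c \in p & d * r ^+ N = c * w].
Proof.
move=> pM mp m0 w0; have [pi [u [pip up piP]]] := uniformizer pM mp m0.
have [N [d [e [dp ep E]]]] := uniformizer_power pM pip up piP w0.
exists N.+1 => r /piP [c rc]; exists (e * u ^+ N.+1), (c ^+ N.+1 * pi * d).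
split; first by rewrite maximal_prime ?maximal_exp.
  have hp := maximal_closed pM.
  have -> : c ^+ N.+1 * pi * d = (c ^+ N.+1 * d) * pi by ring.
  exact: ideal_mul.
rewrite -!mulrA E -exprMn rc exprMn (exprS pi); ring.
Qed.

(** The classes in [A/(m)] killed by a finite intersection of maximal ideals
    form a finitely generated submodule, hence all of them are killed by one
    finite intersection.  By [maximal_colon] each [p] containing [m] is the
    annihilator of such a class, so [p] contains this intersection and is one
    of its members. *)
Lemma finitely_many_maximal m : m != 0 ->
  exists ps : seq {pred A}, (forall p, List.In p ps -> maximal_ideal p) /\
    forall p, maximal_ideal p -> m \in p -> List.In p ps.
Proof.
move=> m0.
pose inter ps t := forall p, List.In p ps -> t \in p.
pose P x := exists2 ps, (forall p, List.In p ps -> maximal_ideal p) &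
  forall t, inter ps t -> exists c, t * x = c * m.
have bounded (ps : seq {pred A}) p :
    (forall q, List.In q ps -> maximal_ideal q) -> maximal_ideal p ->
    (forall t, inter ps t -> t \in p) -> List.In p ps.
  elim: ps => [_ pM /(_ 1)|q ps IHps psM pM psp].
    by move=> /(_ (fun _ => False_ind _)) /(negP (maximal_one pM)).
  have [->|pq] := EM (p = q); first by left.
  right; apply: IHps => // [r rps|t tps]; first by apply: psM; right.
  have [v vq vp] := maximal_sep pM (psM q (or_introl erefl)) pq.
  apply: contrapT => /negP tp; apply: (negP (maximal_prime pM vp tp)).
  apply: psp => r [<-|rps].
    by rewrite mulrC ideal_mul //; exact/maximal_closed/psM/or_introl.
  by apply: ideal_mul; [apply/maximal_closed/psM; right | exact: tps].
have P0 : P 0 by exists [::] => // t _; exists 0; rewrite mulr0 mul0r.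
have PD a x y : P x -> P y -> P (a * x + y).
  move=> [ps psM psP] [qs qsM qsP]; exists (ps ++ qs).
    by move=> p /List.in_app_iff [/psM|/qsM].
  move=> t tpq.
  have [|c e] := psP t.
    by move=> p pps; apply/tpq/List.in_app_iff; left.
  have [|c' e'] := qsP t.
    by move=> p pps; apply/tpq/List.in_app_iff; right.
  exists (a * c + c'); rewrite mulrDr mulrCA e e'; ring.
(* If P holds at 1, some intersection of maximal ideals is contained in (m). *)
have [[ps psM psP]|P1] := EM (P 1).
  exists ps; split=> // p pM mp; apply: bounded => // t /psP [c].
  rewrite mulr1 => ->.
  by apply: ideal_mul => //; exact: maximal_closed.
have [gens [gensI gensP]] := noetherian_generators hN (ideal_of_prop P0 P1 PD).
have [ps psM psP] : exists2 ps,
    (forall p, List.In p ps -> maximal_ideal p) &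
    forall x, P x -> forall t, inter ps t -> exists c, t * x = c * m.
  have /choice [ps psP] : forall i : 'I_(size gens), exists ps,
      (forall p, List.In p ps -> maximal_ideal p) /\
      forall t, inter ps t -> exists c, t * gens`_i = c * m.
    by move=> i; have /asboolP [ps psM psP] := gensI i; exists ps.
  exists (List.flat_map ps (enum 'I_(size gens))).
    by move=> p /List.in_flat_map [i [_ /(psP i).1]].
  move=> x Px t tps.
  have /gensP [c ->] : x \in [pred x | `[< P x >]] by exact/asboolP.
  have /choice [k kP] : forall i : 'I_(size gens),
      exists k, t * gens`_i = k * m.
    move=> i; apply: (psP i).2 => p pps; apply: tps; apply/List.in_flat_map.
    exists i; split=> //.
    have: i \in enum 'I_(size gens) by rewrite mem_enum.
    elim: (enum _) => //= j l IHl.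
    by rewrite inE => /predU1P [->|/IHl]; [left | right].
  exists (\sum_i c i * k i); rewrite mulr_sumr mulr_suml.
  by apply: eq_bigr => i _; rewrite mulrCA kP mulrA.
(* If t avoided p, then t * b would not be a multiple of m. *)
exists ps; split=> // p pM mp; apply: bounded => // t tps.
have [b [bp bN]] := maximal_colon pM mp m0.
have [|c e] := psP b _ t tps; last first.
  by apply: contrapT => /negP tp; exact: bN e.
exists [:: p] => [q [<-|]//|r rp].
by have [|c e] := bp r; [apply: rp; left | exists c].
Qed.

(** The Chinese remainder theorem, for conditions [G p] that are open for the
    [p]-adic topology instead of congruences. *)
Lemma weak_approximation (G : {pred A} -> A -> Prop) (ps : seq {pred A}) :
  (forall p, List.In p ps -> maximal_ideal p) ->
  (forall p, List.In p ps -> exists x, G p x) ->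
  (forall p x, List.In p ps -> G p x ->
    exists N, forall r y, r \in p -> G p (x + r ^+ N * y)) ->
  exists x, forall p, List.In p ps -> G p x.
Proof.
elim: ps => [|p ps IHps] psM psG psO; first by exists 0.
have [|||x0 x0P] := IHps.
- by move=> q qps; apply: psM; right.
- by move=> q qps; apply: psG; right.
- by move=> q x qps; apply: psO; right.
have [pps|pps] := EM (List.In p ps); first by exists x0 => q [<-|]; exact: x0P.
have pM : maximal_ideal p by apply: psM; left.
have hp := maximal_closed pM.
have [|x1 x1P] := psG p; first by left.
have [N NP] : exists N, (forall r y, r \in p -> G p (x1 + r ^+ N * y)) /\
    forall q, List.In q ps -> forall r y, r \in q -> G q (x0 + r ^+ N * y).
  have [|N0 N0P] := psO p x1 _ x1P; first by left.
  have [N1 N1P] : exists N, forall q, List.In q ps ->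
      forall r y, r \in q -> G q (x0 + r ^+ N * y).
    have {}psO q : List.In q ps ->
        exists N, forall r y, r \in q -> G q (x0 + r ^+ N * y).
      by move=> qps; apply: psO; [right | exact: x0P].
    elim: (ps) psO => [|q qs IHqs] qsO; first by exists 0.
    have [|N NP] := IHqs; first by move=> r rqs; apply: qsO; right.
    have [|M MP] := qsO q; first by left.
    exists (N + M)%N => r [<-|rqs] v y vr.
      by rewrite exprD [v ^+ N * _]mulrC -mulrA; exact: MP.
    by rewrite exprD -mulrA; exact: NP.
  exists (N0 + N1)%N; split=> [r y rp|q qps r y rq].
    by rewrite exprD -mulrA; exact: N0P.
  by rewrite exprD [r ^+ N0 * _]mulrC -mulrA; exact: N1P.
have [h hps h1] : exists2 h, forall q, List.In q ps -> h \in q & 1 - h \in p.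
  have [t tps tp] : exists2 t, forall q, List.In q ps -> t \in q & t \notin p.
    elim: (ps) pps psM {IHps psG psO x0P NP} => [|q qs IHqs] pqs qsM.
      by exists 1 => //; exact: maximal_one.
    have [||t tqs tp] := IHqs.
    - by move=> pq; apply: pqs; right.
    - by move=> r [<-//|rqs]; apply: qsM; right; right.
    have qM : maximal_ideal q by apply: qsM; right; left.
    have [|v vq vp] := maximal_sep pM qM; first by move=> e; apply: pqs; left.
    exists (v * t); last exact: maximal_prime.
    move=> r [<-|rqs].
      by rewrite mulrC ideal_mul //; exact: maximal_closed.
    by apply: ideal_mul (tqs _ rqs); apply/maximal_closed/qsM; right; right.
  have [v vp] := maximal_inverse pM tp; exists (t * v) => // q qps.
  by rewrite mulrC ideal_mul ?tps //; apply/maximal_closed/psM; right.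
(* The multiplier 1 - (1 - h^N)^N is a multiple of h^N, and 1 minus it is an
   N-th power of an element of p: it is close to 0 at ps and to 1 at p. *)
have hN1 : 1 - h ^+ N \in p.
  elim: (N) => [|k IHk]; first by rewrite expr0 subrr; case: hp.
  have -> : 1 - h ^+ k.+1 = (1 - h) + h * (1 - h ^+ k) by rewrite exprS; ring.
  by apply: ideal_add => //; exact: ideal_mul.
have [g gE] : exists g, 1 - (1 - h ^+ N) ^+ N = h ^+ N * g.
  elim: (N in (1 - _) ^+ N) => [|k [g e]].
    by exists 0; rewrite expr0 subrr mulr0.
  exists (1 + (1 - h ^+ N) * g); rewrite exprS.
  have -> : 1 - (1 - h ^+ N) * (1 - h ^+ N) ^+ k
   = h ^+ N + (1 - h ^+ N) * (1 - (1 - h ^+ N) ^+ k) by ring.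
  by rewrite e; ring.
exists (x0 + h ^+ N * (g * (x1 - x0))) => q [<-|qps].
  2: exact: NP.2 (hps q qps).
have -> : x0 + h ^+ N * (g * (x1 - x0)) = x1 + (1 - h ^+ N) ^+ N * (x0 - x1).
  by rewrite mulrA -gE; ring.
exact: NP.1.
Qed.

End Dedekind.

(** * p-orderings and Newton interpolation *)

Section Orderings.

Variable A : idomainType.
Implicit Types (p : {pred A}) (s t : seq A) (x y : A).

Definition nodal s y := \prod_(b <- s) (y - b).

(** Up to sign, the Vandermonde determinant of [s]: it avoids [p] exactly when
    the elements of [s] are pairwise incongruent modulo [p]. *)
Fixpoint discr s := if s is x :: s' then nodal s' x * discr s' else 1.

(** Bhargava's notion: every element minimizes the valuation at [p] of the
    product of its differences with those chosen before it.  Lists grow at the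
    head, so the head is the element chosen last. *)
Fixpoint p_ordering p s : Prop :=
  if s is x :: s' then
    p_ordering p s' /\ forall y, ldvd p (nodal s' x) (nodal s' y)
  else True.

Lemma nodal_eq0 s y : (nodal s y == 0) = (y \in s).
Proof.
rewrite /nodal; elim: s => [|b s IHs]; first by rewrite big_nil oner_eq0.
by rewrite big_cons mulf_eq0 IHs inE subr_eq0.
Qed.

Lemma nodal_notin p s y : maximal_ideal p ->
  (nodal s y \notin p) <-> {in s, forall b, y - b \notin p}.
Proof.
move=> pM; rewrite /nodal; elim: s => [|b s [IH1 IH2]].
  by rewrite big_nil; split=> // _; exact: maximal_one.
rewrite big_cons; split=> [bs c|bs].
  have hp := maximal_closed pM.
  rewrite inE => /predU1P [->|].
    by apply: contra bs => yb; rewrite mulrC; exact: ideal_mul.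
  by apply: IH1; apply: contra bs => ys; exact: ideal_mul.
apply: maximal_prime => //; first by apply: bs; exact: mem_head.
by apply: IH2 => c cs; apply: bs; rewrite inE cs orbT.
Qed.

Lemma nodal_add s x h : exists g, nodal s (x + h) = nodal s x + g * h.
Proof.
rewrite /nodal; elim: s => [|b s [g IHs]].
  by exists 0; rewrite !big_nil mul0r addr0.
rewrite !big_cons IHs.
by exists ((x - b) * g + \prod_(c <- s) (x - c) + g * h); ring.
Qed.

Lemma discr_neq0 s : (discr s != 0) = uniq s.
Proof.
by elim: s => /= [|x s <-]; rewrite ?oner_eq0 // mulf_eq0 negb_or nodal_eq0.
Qed.

Lemma discr_notin_cons p x s : maximal_ideal p ->
  discr (x :: s) \notin p <-> nodal s x \notin p /\ discr s \notin p.
Proof.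
move=> pM; split=> [|[]]; last exact: maximal_prime.
have hp := maximal_closed pM.
move=> xs; split; apply: contra xs => h /=; last exact: ideal_mul.
by rewrite mulrC; exact: ideal_mul.
Qed.

Lemma discr_notin_ordering p s :
  maximal_ideal p -> discr s \notin p -> p_ordering p s.
Proof.
move=> pM; elim: s => //= x s IHs /(discr_notin_cons _ _ pM) [sx /IHs ?].
by split=> // y; exact: ldvd_unit.
Qed.

Lemma discr_notin_sep p s x y : maximal_ideal p -> discr s \notin p ->
  x \in s -> y \in s -> x - y \in p -> x = y.
Proof.
move=> pM; elim: s => //= z s IHs /(discr_notin_cons _ _ pM).
move=> [/(nodal_notin _ _ pM) zs sp]; rewrite !inE.
move=> /predU1P [->|xs] /predU1P [->|ys] // xy; last exact: IHs.
  by have /negP := zs _ ys.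
have hp := maximal_closed pM.
by have /negP := zs _ xs; case; rewrite -opprB -mulN1r ideal_mul.
Qed.

(** Two elements of [t] cannot be congruent modulo [p] to the same element of
    [s]. *)
Lemma residue_avoid p t s : maximal_ideal p -> discr t \notin p ->
  (size s < size t)%N -> exists y, nodal s y \notin p.
Proof.
move=> pM tp st; apply: contrapT => noy.
have /choice [g gP] : forall y, exists b, b \in s /\ y - b \in p.
  move=> y; apply: contrapT => nob; apply: noy; exists y.
  by apply/(nodal_notin _ _ pM) => b bs; apply/negP => yb; apply: nob; exists b.
have: uniq [seq g y | y <- t].
  rewrite map_inj_in_uniq.
    by rewrite -discr_neq0; apply: contra tp => /eqP ->; case: pM => -[].
  move=> x y xt yt gxy; apply: (discr_notin_sep pM tp xt yt).
  have -> : x - y = (x - g x) - (y - g y) by rewrite gxy; ring.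
  apply: ideal_sub; first exact: maximal_closed.
    exact: (gP x).2.
  exact: (gP y).2.
move=> tu; move: st; rewrite ltnNge -(size_map g t) => /negP; apply.
by apply: uniq_leq_size tu _ => _ /mapP [y _ ->]; case: (gP y).
Qed.

Definition local_at p (z : {fraction A}) :=
  exists d a, d \notin p /\ tofrac d * z = tofrac a.

Lemma local_at_add p z w : maximal_ideal p ->
  local_at p z -> local_at p w -> local_at p (z + w).
Proof.
move=> pM [d [a [dp e]]] [d' [a' [dp' e']]].
exists (d * d'), (d' * a + d * a'); split; first exact: maximal_prime.
by rewrite tofracD !tofracM -e -e'; ring.
Qed.

Lemma local_at_opp p z : local_at p z -> local_at p (- z).
Proof.
by move=> [d [a [dp e]]]; exists d, (- a); rewrite tofracN -e mulrN.
Qed.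

Lemma nodal_poly s y :
  (\prod_(b <- s) ('X - (tofrac b)%:P)).[tofrac y] = tofrac (nodal s y).
Proof.
rewrite horner_prod /nodal rmorph_prod /=; apply: eq_bigr => b _.
by rewrite !hornerE tofracB.
Qed.

(** Newton's interpolation formula expresses [P] in the products [prod_(b in
    s') (X - b)], for [s'] ranging over the tails of [s].  Evaluating at the
    head [x] of [s] shows that the top term is integral at [x], and minimality
    of [nodal s' x] makes it integral at every point. *)
Lemma newton_interpolation p s (P : {poly {fraction A}}) : maximal_ideal p ->
  p_ordering p s -> (size P <= size s)%N ->
  {in s, forall b, local_at p P.[tofrac b]} ->
  forall y, local_at p P.[tofrac y].
Proof.
move=> pM; elim: s P => [|x s IHs] P /=.
  rewrite leqn0 size_poly_eq0 => _ /eqP -> _ y; exists 1, 0.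
  by rewrite horner0 tofrac0 mulr0; split=> //; exact: maximal_one.
move=> [sP xmin] szP Ps.
pose M := \prod_(b <- s) ('X - (tofrac b)%:P).
have szM : size M = (size s).+1 by rewrite size_prod_XsubC.
have Mmonic : M \is monic by apply: monic_prod_XsubC.
(* Subtracting the top Newton term leaves a polynomial of smaller size with
   the same values on s. *)
pose c := P`_(size s); pose Q := P - c *: M.
have QE y : P.[tofrac y] = Q.[tofrac y] + c * tofrac (nodal s y).
  by rewrite !hornerE nodal_poly subrK.
have szQ : (size Q <= size s)%N.
  apply/leq_sizeP => j; rewrite leq_eqVlt => /predU1P [<-|sj].
    rewrite !coefE -/c; move/monicP: Mmonic; rewrite lead_coefE szM /= => ->.
    by rewrite mulr1 subrr.
  by rewrite !coefE !nth_default ?mulr0 ?subr0 // ?szM // (leq_trans szP).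
have Qloc y : local_at p Q.[tofrac y].
  apply: IHs => // b bs; have := Ps b; rewrite inE bs orbT => /(_ isT).
  have /eqP : nodal s b == 0 by rewrite nodal_eq0.
  by rewrite QE => ->; rewrite tofrac0 mulr0 addr0.
have [d [a [dp e]]] : local_at p (c * tofrac (nodal s x)).
  have -> : c * tofrac (nodal s x) = P.[tofrac x] - Q.[tofrac x].
    by rewrite QE addrAC subrr add0r.
  by apply: local_at_add => //; [apply/Ps/mem_head | exact: local_at_opp].
move=> y; rewrite QE; apply: local_at_add => //.
have [d' [k [dp' e']]] := xmin y.
exists (d * d'), (k * a); split; first exact: maximal_prime.
rewrite !tofracM -e.
have -> : tofrac d * tofrac d' * (c * tofrac (nodal s y))
  = tofrac d * c * (tofrac d' * tofrac (nodal s y)) by ring.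
by rewrite -tofracM e' tofracM; ring.
Qed.

(** Otherwise the denominators of [z] would lie in a maximal ideal [p], and
    [z] would not be integral at [p]. *)
Lemma in_base_local z : noetherian A ->
  (forall p, maximal_ideal p -> local_at p z) -> in_base z.
Proof.
move=> hN zloc; apply: contrapT => nz.
pose I : {pred A} := [pred d | `[< in_base (tofrac d * z) >]].
have hI : idealr_closed I.
  apply: ideal_of_prop.
  - by exists 0; rewrite tofrac0 mul0r.
  - by rewrite tofrac1 mul1r.
  move=> a u v [b e] [b' e']; exists (a * b + b').
  by rewrite !tofracD !tofracM -e -e'; ring.
have [p pM Ip] := ideal_sub_maximal hN hI.
have [d [a [dp e]]] := zloc p pM.
by apply: (negP dp); apply: Ip; apply/asboolP; exists a.
Qed.

Lemma distinct_elements n : dedekind_domain A ->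
  exists2 t : seq A, uniq t & size t = n.
Proof.
move=> hA; have [c c0 cU] := dedekind_not_field hA.
exists [seq c ^+ i | i <- iota 0 n]; last by rewrite size_map size_iota.
rewrite map_inj_uniq ?iota_uniq //.
have inj i k : c ^+ i = c ^+ (i + k) -> k = 0%N.
  case: k => // k; rewrite exprD -{1}[c ^+ i]mulr1.
  move/(mulfI (expf_neq0 i c0)) => e; case/negP: cU.
  by apply/unitrPr; exists (c ^+ k); rewrite -exprS.
move=> i j; wlog ij : i j / (i <= j)%N.
  by move=> h e; have [/h /(_ e)|/ltnW /h /(_ (esym e))] := leqP i j.
by rewrite -{1}(subnKC ij) => /inj; move=> e; rewrite -(subnKC ij) e addn0.
Qed.

End Orderings.

(** * The greedy construction *)

Section Construction.

Variable A : idomainType.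
Hypothesis hA : dedekind_domain A.
Implicit Types (p : {pred A}) (s t : seq A) (x y m : A).

Let hN : noetherian A := dedekind_noetherian hA.

Lemma exists_notin s : exists y, y \notin s.
Proof.
have [t tu st] := distinct_elements (size s).+1 hA.
apply: contrapT => noy; suff: (size t <= size s)%N by rewrite st ltnn.
apply: uniq_leq_size tu _ => y _.
by apply: contrapT => /negP ys; apply: noy; exists y.
Qed.

(** A value of the nodal polynomial of minimal valuation exists at each of the
    finitely many [p] containing [m], and nearby points have the same
    valuation, so approximation gives one point that is minimal at all of
    them. *)
Lemma simultaneous_minimum s m : m != 0 ->
  exists x, forall p, maximal_ideal p -> m \in p ->
    forall y, ldvd p (nodal s x) (nodal s y).
Proof.
move=> m0; have [ps [psM psP]] := finitely_many_maximal hA m0.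
have [y0 y0s] := exists_notin s.
pose G p x := m \in p ->
  nodal s x != 0 /\ forall y, ldvd p (nodal s x) (nodal s y).
have [|||x xP] := @weak_approximation A G ps => //.
- move=> p /psM pM; have [mp|mp] := boolP (m \in p); last first.
    by exists 0 => mp'; rewrite mp' in mp.
  have [|x x0 xmin] := @local_minimum A hA p m (nodal s) pM mp m0.
    by exists y0; rewrite nodal_eq0.
  by exists x.
- move=> p x /psM pM Gx; have hp := maximal_closed pM.
  have [mp|mp] := boolP (m \in p); last first.
    by exists 0%N => r y _ mp'; rewrite mp' in mp.
  have [x0 xmin] := Gx mp.
  have [N NP] := local_power_divisible hA pM mp m0 x0.
  exists N => r y rp _; have [d [c [dp cp e]]] := NP r rp.
  have [g gE] := nodal_add s x (r ^+ N * y).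
  (* Locally the value at the nearby point is a unit times [nodal s x]. *)
  have dE : d * nodal s (x + r ^+ N * y) = (d + g * y * c) * nodal s x.
    rewrite gE mulrDl -[g * y * c * _]mulrA -e; ring.
  have dgp : d + g * y * c \notin p.
    apply: contra dp => h; have -> : d = (d + g * y * c) - g * y * c by ring.
    by apply: ideal_sub => //; exact: ideal_mul.
  split.
    have : (d + g * y * c) * nodal s x != 0.
      by rewrite mulf_neq0 //; apply: contra dgp => /eqP ->; case: hp.
    by rewrite -dE mulf_eq0 negb_or => /andP [].
  move=> z; apply: ldvd_trans (xmin z) => //.
  by exists (d + g * y * c), d.
exists x => p pM mp; exact: (xP p (psP p pM mp) mp).2.
Qed.

(** The invariant of the construction.  The element [m] is chosen to lie in
    all the maximal ideals with few residue classes; there [s] has to be a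
    [p]-ordering.  At the other ones [s] has at most one coincidence modulo
    [p], and when there is one the list [s'] omits one of the two coinciding
    elements. *)
Definition small_or_spread m p s :=
  if m \in p then p_ordering p s else
  discr s \notin p \/
  discr s \in p /\ exists s', [/\ {subset s' <= s}, (size s').+1 = size s,
    discr s' \notin p & {in s, forall a, exists2 b, b \in s' & a - b \in p}].

(** Take [x] minimal at every [p] containing [m * discr s].  At a [p]
    containing [m] this extends the [p]-ordering.  At a [p] with no
    coincidence so far, [x] creates at most one, being congruent to at most
    one element of [s].  At a [p] with a coincidence, [s] occupies at most [n]
    classes while there are more than [n] of them, so the minimal valuation is
    zero and [x] falls in a new class. *)
Lemma extend_spread m t n s : m != 0 -> m \isn't a GRing.unit ->
  (forall p, maximal_ideal p -> m \notin p -> discr t \notin p) ->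
  size t = n.+1 -> (size s <= n.+1)%N -> uniq s ->
  (forall p, maximal_ideal p -> small_or_spread m p s) ->
  exists x, uniq (x :: s) /\
    forall p, maximal_ideal p -> small_or_spread m p (x :: s).
Proof.
move=> m0 mU mt szt szs us sP.
have mds : m * discr s != 0 by rewrite mulf_neq0 // discr_neq0.
have [x xmin] := simultaneous_minimum s mds.
exists x; split.
  rewrite /= us andbT -nodal_eq0; apply/eqP => sx.
  have hI : idealr_closed [pred z | `[< exists v, z = v * m >]].
    apply: ideal_of_prop; first by exists 0; rewrite mul0r.
      by move=> [v e]; case/negP: mU; apply/unitrPr; exists v; rewrite mulrC.
    by move=> a _ _ [u ->] [v ->]; exists (a * u + v); rewrite mulrDl mulrA.
  have [p pM Ip] := ideal_sub_maximal hN hI.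
  have mp : m * discr s \in p.
    by apply: Ip; apply/asboolP; exists (discr s); rewrite mulrC.
  have [y ys] := exists_notin s.
  have [d [c [dp]]] := xmin p pM mp y.
  rewrite sx mulr0 => /eqP.
  rewrite mulf_eq0 nodal_eq0 (negPf ys) orbF => /eqP d0.
  by apply: (negP dp); rewrite d0; case: pM => -[].
move=> p pM; have hp := maximal_closed pM; have := sP p pM.
rewrite /small_or_spread; case: ifPn => mp.
  by split=> // y; apply: xmin => //; rewrite mulrC ideal_mul.
case=> [sp|[sp [s' [s's szs' sp' cover]]]].
  have [sx|sx] := boolP (nodal s x \in p); last first.
    by left; apply/(discr_notin_cons _ _ pM).
  right; split; first by rewrite /= mulrC ideal_mul.
  exists s; split=> // [b bs|a]; first by rewrite inE bs orbT.
  rewrite inE => /predU1P [->|sa]; last first.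
    by exists a => //; rewrite subrr; case: hp.
  apply: contrapT => nob; apply: (negP (_ : nodal s x \notin p)) => //.
  apply/(nodal_notin _ _ pM) => b bs; apply/negP => xb; apply: nob; by exists b.
have [y ys'] : exists y, nodal s' y \notin p.
  by apply: (residue_avoid pM (mt p pM mp)); rewrite szs' szt.
have ys : nodal s y \notin p.
  apply/(nodal_notin _ _ pM) => a sa; have [b bs' ab] := cover a sa.
  have /(nodal_notin _ _ pM) /(_ b bs') := ys'; apply: contra => ya.
  have -> : y - b = (y - a) + (a - b) by ring.
  exact: ideal_add.
have sx : nodal s x \notin p.
  by apply: ldvd_notin ys => //; apply: xmin => //; exact: ideal_mul.
have {}sx := (nodal_notin _ _ pM).1 sx.
right; split; first exact: ideal_mul.
exists (x :: s'); split.
- by move=> b; rewrite !inE => /predU1P [->|/s's ->]; rewrite ?eqxx ?orbT.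
- by rewrite /= szs'.
- apply/(discr_notin_cons _ _ pM); split=> //.
  by apply/(nodal_notin _ _ pM) => b /s's; exact: sx.
move=> a; rewrite inE => /predU1P [->|/cover [b bs' ab]].
  by exists x; rewrite ?mem_head // subrr; case: hp.
by exists b => //; rewrite inE bs' orbT.
Qed.

(** For [t] any [n+1] distinct elements, a maximal ideal not containing [discr
    t] has more than [n] residue classes.  The factor [c], a nonunit, ensures
    that at least one maximal ideal contains [m]; minimality there keeps the
    sequence free of repetitions. *)
Lemma spread_sequence n : exists m s,
  [/\ uniq s, size s = n.+2 &
    forall p, maximal_ideal p -> small_or_spread m p s].
Proof.
have [t tu szt] := distinct_elements n.+1 hA.
have [c c0 cU] := dedekind_not_field hA.
pose m := c * discr t.
have m0 : m != 0 by rewrite mulf_neq0 // discr_neq0.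
have mU : m \isn't a GRing.unit by rewrite unitrM negb_and cU.
have mt p : maximal_ideal p -> m \notin p -> discr t \notin p.
  move=> pM; apply: contra => tp.
  by apply: ideal_mul => //; exact: maximal_closed.
exists m; suff: forall k, (k <= n.+2)%N -> exists s, [/\ uniq s, size s = k &
    forall p, maximal_ideal p -> small_or_spread m p s] by apply.
elim=> [_|k IHk kn].
  exists [::]; split=> // p pM; rewrite /small_or_spread; case: ifP => //= _.
  by left; exact: maximal_one.
have [s [su szs sP]] := IHk (ltnW kn).
have [|x [xu xP]] := extend_spread m0 mU mt szt _ su sP; first by rewrite szs.
by exists (x :: s); split=> //=; rewrite szs.
Qed.

Lemma small_or_spread_ordering m p s n : maximal_ideal p -> size s = n.+1 ->
  small_or_spread m p s ->
  exists s', [/\ {subset s' <= s}, size s' = n & p_ordering p s'].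
Proof.
move=> pM; case: s => //= x s [szs].
have sub : {subset s <= x :: s} by move=> b bs; rewrite inE bs orbT.
rewrite /small_or_spread; case: ifP => [_ [? _]|_]; first by exists s.
case=> [/(discr_notin_cons _ _ pM) [_ sp]|[_ [s' [? [szs'] sp' _]]]].
  by exists s; split=> //; exact: discr_notin_ordering.
by exists s'; split; rewrite ?szs' //; exact: discr_notin_ordering.
Qed.

End Construction.

Theorem theorem1p3 (A : idomainType) (hA : dedekind_domain A) (n : nat) :
  exists S : {fset A}, universal_set n S /\ #|` S|%fset = n.+2.
Proof.
have [m [s [su szs sP]]] := spread_sequence hA n.
exists [fset x in s]%fset; split; last first.
  by rewrite card_fseq undup_id.
move=> P szP; split=> [Pall a _|PS a]; first exact: Pall.
apply: in_base_local => [|p pM]; first exact: dedekind_noetherian.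
have [s' [s's szs' sp']] := small_or_spread_ordering pM szs (sP p pM).
apply: (newton_interpolation pM sp'); first by rewrite szs'.
move=> b /s's bs; have [|c ->] := PS b; first by rewrite inE.
by exists 1, c; rewrite tofrac1 mul1r; split=> //; exact: maximal_one.
Qed.
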